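(* Let $(X,Y,\langle\cdot,\cdot\rangle)$ be an asymmetric dual pair, with $X$ carrying $\sigma(X,Y)$ and $Y$ carrying $\sigma(Y,X)$. If $(X,\sigma_s(X,Y))$ has countable tightness and is Lindelöf, and $Y$ is separable, then every countably compact subset of $X$ is compact.
   Context: All vector spaces and cones are over the reals; a cone is a commutative monoid $(Y,+,0)$ with a scalar multiplication by nonnegative reals satisfying the usual vector space axioms. An asymmetric dual pair $(X,Y,\langle\cdot,\cdot\rangle)$ consists of a vector space $X$, a cone $Y$ and a map $\langle\cdot,\cdot\rangle:X\times Y\to\mathbb R$ that is bilinear (with respect to nonnegative scalars in the second variable) and nondegenerate: $\langle x,\cdot\rangle=0$ implies $x=0$, and $\langle\cdot,y\rangle=\langle\cdot,z\rangle$ implies $y=z$. $\sigma(X,Y)$ is the topology on $X$ with basis the sets $\{x'\in X:\langle x'-x,y\rangle<\epsilon\ \forall y\in F\}$, with $x\in X$, $\epsilon>0$, $F\subseteq Y$ finite. $\overline\sigma(X,Y)$ is the conjugate topology, with basis the sets $\{x'\in X:\langle x-x',y\rangle<\epsilon\ \forall y\in F\}$. $\sigma_s(X,Y)$ is the smallest topology containing both. $\sigma(Y,X)$ is the topology on $Y$ of pointwise convergence on $X$. Topological spaces are not assumed Hausdorff. A set is compact (resp. countably compact) if every open cover (resp. countable open cover) has a finite subcover; a space is Lindelöf if every open cover has a countable subcover. A space has countable tightness if whenever $x\in\mathrm{cl}\,A$ there is a countable $S\subseteq A$ with $x\in\mathrm{cl}\,S$. *)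

(* Defs.v *)
From HB Require Import structures.
From mathcomp Require Import all_boot all_order all_algebra finmap.
From mathcomp Require Import all_classical all_reals all_analysis.
Import Order.TTheory GRing.Theory Num.Theory numFieldNormedType.Exports.

Set Implicit Arguments.
Unset Strict Implicit.
Unset Printing Implicit Defensive.

Local Open Scope classical_set_scope.
Local Open Scope ring_scope.

(* The library has no semiring structure on {nonneg R}; with it, a cone is a
   semimodule over {nonneg R}. *)
Section NonnegSemiring.
Context {R : realType}.
Implicit Types a b c : {nonneg R}.

Let nng_add a b : {nonneg R} := (a%:num + b%:num)%:nng.
Let nng_mul a b : {nonneg R} := (a%:num * b%:num)%:nng.
Let nng0 : {nonneg R} := 0%:nng.
Let nng1 : {nonneg R} := 1%:nng.

Fact nng_addA : associative nng_add.
Proof. by move=> a b c; apply/val_inj; rewrite /= addrA. Qed.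

Fact nng_addC : commutative nng_add.
Proof. by move=> a b; apply/val_inj; rewrite /= addrC. Qed.

Fact nng_add0 : left_id nng0 nng_add.
Proof. by move=> a; apply/val_inj; rewrite /= add0r. Qed.

HB.instance Definition _ := Order.POrder.on {nonneg R}.
HB.instance Definition _ :=
  GRing.isNmodule.Build {nonneg R} nng_addA nng_addC nng_add0.

Fact nng_mulA : associative nng_mul.
Proof. by move=> a b c; apply/val_inj; rewrite /= mulrA. Qed.

Fact nng_mulC : commutative nng_mul.
Proof. by move=> a b; apply/val_inj; rewrite /= mulrC. Qed.

Fact nng_mul1 : left_id nng1 nng_mul.
Proof. by move=> a; apply/val_inj; rewrite /= mul1r. Qed.

Fact nng_mulDl : left_distributive nng_mul nng_add.
Proof. by move=> a b c; apply/val_inj; rewrite /= mulrDl. Qed.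

Fact nng_mul0 : left_zero nng0 nng_mul.
Proof. by move=> a; apply/val_inj; rewrite /= mul0r. Qed.

HB.instance Definition _ :=
  GRing.Nmodule_isComPzSemiRing.Build {nonneg R}
    nng_mulA nng_mulC nng_mul1 nng_mulDl nng_mul0.

Lemma nng_addE a b : (a + b)%:num = a%:num + b%:num :> R.
Proof. by []. Qed.

Lemma nng_mulE a b : (a * b)%:num = a%:num * b%:num :> R.
Proof. by []. Qed.

Lemma nng_0E : (0 : {nonneg R})%:num = 0 :> R.
Proof. by []. Qed.

Lemma nng_1E : (1 : {nonneg R})%:num = 1 :> R.
Proof. by []. Qed.

End NonnegSemiring.

Notation coneType R := (lSemiModType {nonneg R}).

Record asym_dual_pair (R : realType) (X : lmodType R) (Y : coneType R) := {
  pairing :> X -> Y -> R ;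
  pairing_linearl : forall y, scalar (pairing^~ y) ;
  pairingDr : forall x y z, pairing x (y + z) = pairing x y + pairing x z ;
  pairingZr : forall x (a : {nonneg R}) y,
    pairing x (a *: y) = a%:num * pairing x y ;
  pairing_nondegl : forall x, (forall y, pairing x y = 0) -> x = 0 ;
  pairing_nondegr : forall y z, (forall x, pairing x y = pairing x z) -> y = z
}.

Section Topologies.
Context {R : realType} {X : lmodType R} {Y : coneType R}.
Implicit Type P : asym_dual_pair X Y.

Definition sigma_ball P (x : X) (e : R) (F : {fset Y}) : set X :=
  [set x' | forall y, y \in F -> P (x' - x) y < e].

Definition sigma_bar_ball P (x : X) (e : R) (F : {fset Y}) : set X :=
  [set x' | forall y, y \in F -> P (x - x') y < e].

Definition sigma_base P : set (set X) :=
  [set U | exists x e F, 0 < e /\ U = sigma_ball P x e F].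

Definition sigma_bar_base P : set (set X) :=
  [set U | exists x e F, 0 < e /\ U = sigma_bar_ball P x e F].

(* sigmaX, sigmaX_bar and sigmaX_s below are copies of X that carry the three
   topologies; sigmaY is Y with pointwise convergence on X. *)
Definition sigmaX P : Type := X.
Definition sigmaX_bar P : Type := X.

Lemma pairingDl P x x' y : P (x + x') y = P x y + P x' y.
Proof. by have := pairing_linearl P y 1 x x'; rewrite scale1r mul1r. Qed.

Lemma pairing0l P y : P 0 y = 0.
Proof. by apply/(addrI (P 0 y)); rewrite -pairingDl !addr0. Qed.

Lemma fset_slack (g : Y -> R) (e : R) (F : {fset Y}) : 0 < e ->
  (forall y, y \in F -> g y < e) ->
  exists2 d, 0 < d & forall y, y \in F -> g y + d <= e.
Proof.
move=> e0; suff H (s : seq Y) : (forall y, y \in s -> g y < e) ->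
  exists2 d, 0 < d & forall y, y \in s -> g y + d <= e by exact: H.
elim: s => [|z s IH] H; first by exists 1.
have [|d d0 hd] := IH; first by move=> y ys; apply: H; rewrite inE ys orbT.
exists (Num.min d (e - g z)) => [|y].
  by rewrite lt_min d0 subr_gt0 H// mem_head.
rewrite inE => /predU1P[->|ys].
  by rewrite addrC -lerBrDr ge_min lexx orbT.
by apply: le_trans (hd _ ys); rewrite lerD2l ge_min lexx.
Qed.

Lemma sigma_base_cover P : \bigcup_(U in sigma_base P) U = setT.
Proof.
apply/seteqP; split=> // x _; exists (sigma_ball P x 1 fset0) => //.
by exists x, 1, fset0.
Qed.

Lemma sigma_bar_base_cover P : \bigcup_(U in sigma_bar_base P) U = setT.
Proof.
apply/seteqP; split=> // x _; exists (sigma_bar_ball P x 1 fset0) => //.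
by exists x, 1, fset0.
Qed.

Lemma sigma_base_join P (U V : set X) t :
  sigma_base P U -> sigma_base P V -> U t -> V t ->
  exists W, [/\ sigma_base P W, W t & W `<=` U `&` V].
Proof.
move=> [x [e [F [e0 ->]]]] [x' [e' [F' [e'0 ->]]]] Ut Vt.
have [d d0 hd] := fset_slack e0 Ut; have [d' d'0 hd'] := fset_slack e'0 Vt.
exists (sigma_ball P t (Num.min d d') (F `|` F')%fset); split.
- by exists t, (Num.min d d'), (F `|` F')%fset; rewrite lt_min d0.
- by move=> y _; rewrite subrr pairing0l lt_min d0.
- move=> w Ww; split=> y yF.
  + apply: lt_le_trans (hd y yF).
    have -> : w - x = (t - x) + (w - t) by rewrite [RHS]addrC subrKA.
    rewrite pairingDl.
    rewrite ltrD2l; have := Ww y.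
    by rewrite in_fsetU yF lt_min => /(_ isT)/andP[].
  + apply: lt_le_trans (hd' y yF).
    have -> : w - x' = (t - x') + (w - t) by rewrite [RHS]addrC subrKA.
    rewrite pairingDl.
    rewrite ltrD2l; have := Ww y.
    by rewrite in_fsetU yF orbT lt_min => /(_ isT)/andP[].
Qed.

Lemma sigma_bar_base_join P (U V : set X) t :
  sigma_bar_base P U -> sigma_bar_base P V -> U t -> V t ->
  exists W, [/\ sigma_bar_base P W, W t & W `<=` U `&` V].
Proof.
move=> [x [e [F [e0 ->]]]] [x' [e' [F' [e'0 ->]]]] Ut Vt.
have [d d0 hd] := fset_slack e0 Ut; have [d' d'0 hd'] := fset_slack e'0 Vt.
exists (sigma_bar_ball P t (Num.min d d') (F `|` F')%fset); split.
- by exists t, (Num.min d d'), (F `|` F')%fset; rewrite lt_min d0.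
- by move=> y _; rewrite subrr pairing0l lt_min d0.
- move=> w Ww; split=> y yF.
  + apply: lt_le_trans (hd y yF).
    have -> : x - w = (x - t) + (t - w) by rewrite subrKA.
    rewrite pairingDl.
    rewrite ltrD2l; have := Ww y.
    by rewrite in_fsetU yF lt_min => /(_ isT)/andP[].
  + apply: lt_le_trans (hd' y yF).
    have -> : x' - w = (x' - t) + (t - w) by rewrite subrKA.
    rewrite pairingDl.
    rewrite ltrD2l; have := Ww y.
    by rewrite in_fsetU yF orbT lt_min => /(_ isT)/andP[].
Qed.

HB.instance Definition _ P := Choice.copy (sigmaX P) X.
HB.instance Definition _ P := isBaseTopological.Build (sigmaX P)
  (sigma_base_cover P) (@sigma_base_join P).

HB.instance Definition _ P := Choice.copy (sigmaX_bar P) X.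
HB.instance Definition _ P := isBaseTopological.Build (sigmaX_bar P)
  (sigma_bar_base_cover P) (@sigma_bar_base_join P).

Definition sigmaX_s P : Type := sup_topology (fun b : bool =>
  if b then Topological.class (sigmaX P) else Topological.class (sigmaX_bar P)).
HB.instance Definition _ P := Topological.on (sigmaX_s P).

Definition sigmaY P : Type :=
  initial_topology (fun y : Y => (P^~ y : {ptws X -> R})).
HB.instance Definition _ P := Topological.on (sigmaY P).

End Topologies.

Section TopologicalNotions.
Variable T : topologicalType.

Definition countably_compact (A : set T) :=
  forall (I : choiceType) (D : set I) (f : I -> set T), countable D ->
  (forall i, D i -> open (f i)) -> A `<=` cover D f ->
  finite_subset_cover D f A.

Definition lindelof :=
  forall (I : choiceType) (D : set I) (f : I -> set T),
  (forall i, D i -> open (f i)) -> cover D f = setT ->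
  exists D' : set I, [/\ D' `<=` D, countable D' & cover D' f = setT].

Definition countably_tight :=
  forall (A : set T) (x : T), closure A x ->
  exists S : set T, [/\ S `<=` A, countable S & closure S x].

Definition separable_space := exists2 S : set T, countable S & dense S.

End TopologicalNotions.

(* Main.v *)
Require Import Defs.
From mathcomp Require Import all_boot all_order all_algebra.
From mathcomp Require Import all_classical all_reals all_analysis.
From mathcomp Require Import finmap.
Import Order.TTheory GRing.Theory Num.Theory numFieldNormedType.Exports.

(** The topology [sigma(X, Y)] only sees sets up to the preorder in which [x]
    lies below [k] when [<x, y> <= <k, y>] for all [y]: its open sets are
    lower sets.  Hence a set [K] and its lower hull, the set of points lying
    below some point of [K], have the same open covers, and it suffices to
    show that the lower hull of a countably compact [K] is closed for
    [sigma_s(X, Y)] ([closed_lower_hull]).  Indeed, since [sigma_s] is finer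
    than [sigma], a cover of [K] by [sigma]-open sets then becomes, together
    with the complement of the hull, a [sigma_s]-open cover of [X]; the
    Lindelöf property extracts a countable subcover, and countable compactness
    a finite one.

    The hull is closed for the following reason.  Let [x] be outside the hull
    and [S] a countable dense subset of [Y].  By density, each [k] in [K]
    satisfies [<k, d> < q < <x, d>] for some [d] in [S] and some rational [q]
    ([dense_separates]).  So countably many [sigma]-open half-spaces
    [{ <., d> < q }] cover [K], and finitely many of them suffice.  The
    corresponding opposite half-spaces [{ <., d> > q }] are [sigma_bar]-open
    and contain [x], and their finite intersection is a neighborhood of [x]
    that misses the hull: a point of it lying below [k] would satisfy
    [q < <k, d>] for all the chosen pairs [(d, q)]. *)

Set Implicit Arguments.
Unset Strict Implicit.
Unset Printing Implicit Defensive.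

Local Open Scope classical_set_scope.
Local Open Scope ring_scope.

Section AsymmetricDualPair.
Context {R : realType} {X : lmodType R} {Y : coneType R}.
Variable P : asym_dual_pair X Y.

Lemma pairingBl x x' y : P (x - x') y = P x y - P x' y.
Proof. by apply/eqP; rewrite eq_sym subr_eq -pairingDl subrK. Qed.

Definition below (x k : X) := forall y, P x y <= P k y.

Definition lower_hull (K : set X) : set X :=
  [set x | exists2 k, K k & below x k].

Lemma sub_lower_hull (K : set X) : K `<=` lower_hull K.
Proof. by move=> k Kk; exists k. Qed.

(** Basic open sets bound the values [<x', y>] from above only. *)
Lemma open_sigma_lower (U : set (sigmaX P)) x k :
  open U -> U k -> below x k -> U x.
Proof.
move=> [B sB <-] [V BV Vk] xk; exists V => //.
have [a [e [F [_ VE]]]] := sB _ BV; move: Vk; rewrite VE => Vk y yF.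
by apply: le_lt_trans (Vk y yF); rewrite !pairingBl lerD2r.
Qed.

Lemma open_sigma_halfspace y (q : R) :
  open ([set x | P x y < q] : set (sigmaX P)).
Proof.
exists [set V | sigma_base P V /\ V `<=` [set x | P x y < q]].
  by move=> V [].
apply/seteqP; split=> [x [V [_ +]]|x xq]; first exact.
exists (sigma_ball P x (q - P x y) [fset y]%fset).
  split; first by exists x, (q - P x y), [fset y]%fset; rewrite subr_gt0.
  by move=> z /(_ y); rewrite inE eqxx pairingBl ltrD2r; apply.
by move=> z _; rewrite subrr pairing0l subr_gt0.
Qed.

Lemma open_sigma_bar_halfspace y (q : R) :
  open ([set x | q < P x y] : set (sigmaX_bar P)).
Proof.
exists [set V | sigma_bar_base P V /\ V `<=` [set x | q < P x y]].
  by move=> V [].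
apply/seteqP; split=> [x [V [_ +]]|x xq]; first exact.
exists (sigma_bar_ball P x (P x y - q) [fset y]%fset).
  split; first by exists x, (P x y - q), [fset y]%fset; rewrite subr_gt0.
  by move=> z /(_ y); rewrite inE eqxx pairingBl ltrD2l ltrN2; apply.
by move=> z _; rewrite subrr pairing0l subr_gt0.
Qed.

Lemma open_sigma_s_subbase (U : set (sigmaX_s P)) :
  @open (sigmaX P) U \/ @open (sigmaX_bar P) U -> open U.
Proof.
move=> oU; exists [set U]; last by rewrite bigcup_set1.
move=> _ ->; exists [fset (U : set X)]%fset; last first.
  by rewrite set_fset1 bigcap_set1.
move=> V; rewrite inE => /eqP ->; apply/mem_set.
by case: oU => oU; [exists true|exists false].
Qed.

(** The condition on [d] is open for pointwise convergence on [X], because it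
    holds as soon as a fixed real number separates the two values. *)
Lemma dense_separates (S : set (sigmaY P)) k x y : dense S ->
  P k y < P x y -> exists2 d, S d & P k d < P x d.
Proof.
move=> dS kx; set c := (P k y + P x y) / 2.
have evalc z : continuous (fun d : sigmaY P => P z d).
  move=> d; apply: (@continuous_comp (sigmaY P) {ptws X -> R} R
    (fun d : Y => (P^~ d : {ptws X -> R})) (fun f => f z)).
    exact: initial_continuous.
  exact: (@proj_continuous X (fun=> R) z).
pose O : set (sigmaY P) := (P k @^-1` [set t | t < c]) `&`
                           (P x @^-1` [set t | c < t]).
have oO : open O.
  apply: openI; apply: open_comp => [? _|]; do ?exact: evalc.
    exact: open_lt.
  exact: open_gt.
have [|d [[/= kc cx] Sd]] := dS O _ oO.
  by exists y; split; rewrite /= ?midf_lt.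
by exists d => //; exact: lt_trans cx.
Qed.

Lemma closed_lower_hull (K : set (sigmaX P)) : separable_space (sigmaY P) ->
  countably_compact K -> closed (lower_hull K : set (sigmaX_s P)).
Proof.
move=> [S cS dS] ccK; rewrite -openC openE => x xK.
pose D : set (Y * rat) := [set i | S i.1 /\ ratr i.2 < P x i.1].
pose f (i : Y * rat) : set (sigmaX P) := [set k | P k i.1 < ratr i.2].
have cD : countable D.
  apply: (sub_countable (B := S `*` [set: rat])).
    by apply: subset_card_le => i [].
  exact: countableX.
have Kf : K `<=` cover D f.
  move=> k Kk; have /existsNP[y /negP] : ~ below x k.
    by move=> xk; apply: xK; exists k.
  rewrite -ltNge => /(dense_separates dS)[d Sd /rat_in_itvoo[q]].
  by rewrite in_itv/= => /andP[kq qx]; exists (d, q).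
have [|D' sD' KD'] := ccK _ D f cD _ Kf.
  by move=> i _; exact: open_sigma_halfspace.
pose g (i : Y * rat) : set (sigmaX_s P) := [set z | ratr i.2 < P z i.1].
apply: (@filterS _ _ _ (\bigcap_(i in [set` D']) g i)).
  move=> z gz [k Kk zk]; have [i iD' ki] := KD' _ Kk.
  have /lt_le_trans/(_ (zk i.1)) := gz i iD'.
  by move/lt_trans/(_ ki); rewrite ltxx.
apply: filter_bigI => i /sD'/set_mem[_ xi].
apply: open_nbhs_nbhs; split=> //.
by apply: open_sigma_s_subbase; right; exact: open_sigma_bar_halfspace.
Qed.

End AsymmetricDualPair.

Theorem theorem4p10 (R : realType) (X : lmodType R) (Y : coneType R)
    (P : asym_dual_pair X Y)
    (tightX : countably_tight (sigmaX_s P))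
    (lindelofX : lindelof (sigmaX_s P))
    (sepY : separable_space (sigmaY P))
    (K : set (sigmaX P)) (ccK : countably_compact K) :
  cover_compact K.
Proof.
move=> I D f oD KD.
have [D0|/set0P[i0 Di0]] := eqVneq D set0.
  by apply: ccK; rewrite // D0; exact: countable0.
pose C : set (sigmaX_s P) := lower_hull P K.
have oC : open (~` C) by rewrite openC; exact: closed_lower_hull.
(* Adding the complement of the hull to every member keeps the index set; [i0]
   ensures that the enlarged family does cover the complement. *)
have [i Di||D' [sD' cD' D'T]] := lindelofX I D (fun i => f i `|` ~` C).
- by apply: openU oC; apply: open_sigma_s_subbase; left; exact: oD.
- apply/seteqP; split=> // x _; have [[k Kk xk]|nCx] := pselect (C x).
    have [i Di fik] := KD k Kk; exists i => //; left.
    exact: open_sigma_lower (oD i Di) fik xk.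
  by exists i0 => //; right.
have [||D'' sD'' KD''] := ccK I D' f cD'.
- by move=> i /sD'; exact: oD.
- move=> k Kk; have [i D'i [fik|[]]] : cover D' (fun i => f i `|` ~` C) k.
    by rewrite D'T.
  + by exists i.
  + exact: sub_lower_hull.
by exists D'' => // i /sD''/set_mem/sD' Di; exact/mem_set.
Qed.
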